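(* Let $G$ be a graph on $n$ vertices with edge connectivity $\kappa'$, where $0\leq\kappa'\leq n-1$. Then $SLEE(G)\leq SLEE(K_{(n-1-\kappa',1)\kappa'})$, with equality if and only if $G\cong K_{(n-1-\kappa',1)\kappa'}$.
   Context: All graphs are finite and simple. For a graph $G$ on $n$ vertices, let $\mathbf{Q}(G)=\mathbf{D}(G)+\mathbf{A}(G)$ be its signless Laplacian matrix, where $\mathbf{A}(G)$ is the adjacency matrix and $\mathbf{D}(G)$ the diagonal matrix of vertex degrees; let $q_1,\dots,q_n$ be the eigenvalues of $\mathbf{Q}(G)$. The signless Laplacian Estrada index of $G$ is $SLEE(G)=\sum_{i=1}^n e^{q_i}$. $G\cup H$ denotes the vertex-disjoint union of graphs $G$ and $H$, and $G\vee H$ denotes their join, obtained from $G\cup H$ by joining every vertex of $G$ to every vertex of $H$. $K_m$ is the complete graph on $m$ vertices. For $p\geq q\geq 1$ and $r\geq 1$, $K_{(p,q)r}=(K_p\cup K_q)\vee K_r$. By convention, $K_{(0,1)(n-1)}$ denotes $K_n$, and $K_{(n-1,1)0}$ denotes $K_{n-1}\cup K_1$. The edge connectivity of a graph with at least two vertices is the minimum number of edges whose removal disconnects it ($0$ if the graph is disconnected); the edge connectivity of $K_n$ is $n-1$ (in particular that of $K_1$ is $0$). *)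

(* Defs.v *)
From HB Require Import structures.
From mathcomp Require Import all_boot all_order all_algebra.
From mathcomp Require Import sesquilinear spectral complex.
From mathcomp Require Import boolp classical_sets reals sequences exp.

Set Implicit Arguments.
Unset Strict Implicit.
Unset Printing Implicit Defensive.

Import Order.TTheory GRing.Theory Num.Theory.

Local Open Scope ring_scope.

(* Finite simple graphs; the vertex set may be empty, so that K_0 exists. *)

Record sgraph := SGraph {
  vertex :> finType;
  adj : rel vertex;
  adj_sym : symmetric adj;
  adj_irrefl : irreflexive adj }.

Arguments adj {_} _ _.

Definition sg_iso (G H : sgraph) : Prop :=
  exists f : G -> H, bijective f /\ forall x y, adj (f x) (f y) = adj x y.

Definition complete_rel (n : nat) : rel 'I_n := fun x y => x != y.

Lemma complete_rel_sym n : symmetric (@complete_rel n).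
Proof. by move=> x y; rewrite /complete_rel eq_sym. Qed.

Lemma complete_rel_irrefl n : irreflexive (@complete_rel n).
Proof. by move=> x; rewrite /complete_rel eqxx. Qed.

Definition complete_graph (n : nat) : sgraph :=
  SGraph (@complete_rel_sym n) (@complete_rel_irrefl n).

Definition union_rel (G H : sgraph) : rel (G + H) := fun u v =>
  match u, v with
  | inl x, inl y => adj x y
  | inr x, inr y => adj x y
  | _, _ => false
  end.

Lemma union_rel_sym G H : symmetric (@union_rel G H).
Proof. by case=> x [] y //=; rewrite adj_sym. Qed.

Lemma union_rel_irrefl G H : irreflexive (@union_rel G H).
Proof. by case=> x /=; rewrite adj_irrefl. Qed.

Definition graph_union (G H : sgraph) : sgraph :=
  SGraph (@union_rel_sym G H) (@union_rel_irrefl G H).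

Definition join_rel (G H : sgraph) : rel (G + H) := fun u v =>
  match u, v with
  | inl x, inl y => adj x y
  | inr x, inr y => adj x y
  | _, _ => true
  end.

Lemma join_rel_sym G H : symmetric (@join_rel G H).
Proof. by case=> x [] y //=; rewrite adj_sym. Qed.

Lemma join_rel_irrefl G H : irreflexive (@join_rel G H).
Proof. by case=> x /=; rewrite adj_irrefl. Qed.

Definition graph_join (G H : sgraph) : sgraph :=
  SGraph (@join_rel_sym G H) (@join_rel_irrefl G H).

(* K_{(p,q)r}.  Since K_0 is the null graph, [Kpqr 0 1 m] is isomorphic to
   K_(m+1), and [Kpqr m 1 0] to the disjoint union of K_m and K_1, as the usual
   conventions for these degenerate parameters require. *)
Definition Kpqr (p q r : nat) : sgraph :=
  graph_join (graph_union (complete_graph p) (complete_graph q))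
             (complete_graph r).

Definition edges (G : sgraph) : {set {set G}} :=
  [set [set e.1; e.2] | e in [set e : G * G | adj e.1 e.2]].

Definition del_rel (G : sgraph) (F : {set {set G}}) : rel G :=
  fun x y => adj x y && ([set x; y] \notin F).

Lemma del_rel_sym G F : symmetric (@del_rel G F).
Proof. by move=> x y; rewrite /del_rel adj_sym finset.setUC. Qed.

Lemma del_rel_irrefl G F : irreflexive (@del_rel G F).
Proof. by move=> x; rewrite /del_rel adj_irrefl. Qed.

Definition del_edges (G : sgraph) (F : {set {set G}}) : sgraph :=
  SGraph (@del_rel_sym G F) (@del_rel_irrefl G F).

Definition sg_connected (G : sgraph) : bool :=
  [forall x : G, forall y : G, connect adj x y].

Definition disconnecting (G : sgraph) (F : {set {set G}}) : bool :=
  (F \subset edges G) && ~~ sg_connected (del_edges F).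

(* [edges G] is only the starting point of the search for a minimum: it is a
   disconnecting set as soon as G has two vertices (see below). *)
Definition edge_connectivity (G : sgraph) : nat :=
  if (#|G| <= 1)%N then 0%N
  else #|[arg min_(F < edges G | disconnecting F) #|F|]|.

Lemma disconnecting_edges (G : sgraph) :
  (1 < #|G|)%N -> disconnecting (edges G).
Proof.
case/card_gt1P=> x [y [_ _ neq_xy]]; rewrite /disconnecting subxx /=.
apply/negP=> /forallP/(_ x)/forallP/(_ y)/connectP[[|z p] /=].
  by move=> _ eq_yx; rewrite eq_yx eqxx in neq_xy.
case/andP=> /andP[adj_xz /negP nE] _ _; case: nE.
by apply/imsetP; exists (x, z); rewrite ?inE.
Qed.

Lemma edge_connectivity_min (G : sgraph) : (1 < #|G|)%N ->
  (exists2 F : {set {set G}}, disconnecting F & #|F| = edge_connectivity G) /\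
  (forall F : {set {set G}}, disconnecting F -> (edge_connectivity G <= #|F|)%N).
Proof.
move=> G_gt1; rewrite /edge_connectivity leqNgt G_gt1 /=.
case: arg_minnP => [|F disF minF]; first exact: disconnecting_edges.
by split; first exists F.
Qed.

Section Spectrum.
Variable R : realType.

(* The eigenvalues of A with algebraic multiplicities, in some order
   (the empty sequence if the characteristic polynomial does not split in R). *)
Definition eigenvalues (n : nat) (A : 'M[R]_n) : seq R :=
  xget [::] [set s : seq R | char_poly A = \prod_(q <- s) ('X - q%:P)]%classic.

Lemma eigenvaluesP (n : nat) (A : 'M[R]_n) : A^T = A ->
  char_poly A = \prod_(q <- eigenvalues A) ('X - q%:P).
Proof.
move=> symA; pose S := [set s : seq R | char_poly A = \prod_(q <- s) ('X - q%:P)]%classic.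
suff S_neq0 : exists s, S s by exact: (xgetPex [::] S_neq0).
rewrite /S /=.
pose f := real_complex R.
pose B := map_mx f A.
have hB : B \is hermitianmx _ false Num.Def.conjC.
  apply: realsym_hermsym.
    by apply/is_hermitianmxP; rewrite expr0 scale1r map_mx_id //; apply/matrixP => i j; rewrite !mxE -{1}symA mxE.
  apply/mxOverP => i j; rewrite mxE; apply/complex_realP.
  by exists (A i j).
have /orthomx_spectralP eqB := hermitian_normalmx hB.
have realD := hermitian_spectral_diag_real hB.
set P := spectralmx B in eqB; set D := spectral_diag B in eqB realD.
have P_unit : P \in unitmx by exact: spectral_unit.
have /fin_all_exists[d dE] : forall i, exists x : R, D 0 i = f x.
  by move=> i; apply/complex_realP; exact: (mxOverP realD).
exists [seq d i | i <- enum 'I_n]; apply: (map_poly_inj f).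
rewrite map_char_poly -/B big_map big_enum /= rmorph_prod /=.
have -> : char_poly B = char_poly (diag_mx D).
  rewrite {1}eqB /char_poly /char_poly_mx.
  have PV : map_mx polyC (invmx P) *m map_mx polyC P = 1%:M.
    by rewrite -map_mxM mulVmx // map_mx1.
  have -> : 'X%:M - map_mx polyC (invmx P *m diag_mx D *m P) =
      map_mx polyC (invmx P) *m ('X%:M - map_mx polyC (diag_mx D))
        *m map_mx polyC P.
    by rewrite mulmxBr mulmxBl !map_mxM scalar_mxC -(mulmxA 'X%:M) PV mulmx1.
  by rewrite !det_mulmx mulrAC -det_mulmx PV det1 mul1r.
rewrite char_poly_trig ?diag_mx_is_trig //; apply: eq_bigr => i _.
by rewrite rmorphB /= map_polyX map_polyC /= mxE eqxx mulr1n dE.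
Qed.

Section SignlessLaplacian.
Variable G : sgraph.

Definition degree (x : G) : nat := #|[set y | adj x y]|.

Definition adjacency_matrix : 'M[R]_#|G| :=
  \matrix_(i, j) (adj (enum_val i : G) (enum_val j))%:R.

Definition degree_matrix : 'M[R]_#|G| :=
  diag_mx (\row_i (degree (enum_val i))%:R).

Definition signless_laplacian : 'M[R]_#|G| :=
  degree_matrix + adjacency_matrix.

Definition SLEE : R := \sum_(q <- eigenvalues signless_laplacian) expR q.

Lemma signless_laplacian_sym : signless_laplacian^T = signless_laplacian.
Proof.
rewrite /signless_laplacian linearD /= tr_diag_mx; congr (_ + _).
by apply/matrixP => i j; rewrite !mxE adj_sym.
Qed.

End SignlessLaplacian.
End Spectrum.

(* Main.v *)
Require Import Defs.
From mathcomp Require Import boolp classical_sets reals topology normedtype.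
From mathcomp Require Import sequences exp.
From mathcomp Require Import all_boot all_order all_algebra.
From mathcomp Require Import sesquilinear spectral complex ring lra zify.

Import Order.TTheory GRing.Theory Num.Theory.
Import numFieldNormedType.Exports.

Local Open Scope ring_scope.

(* SLEE(G) is the sum over m of tr(Q^m) / m!, so it suffices to compare all the
   moments tr(Q^m), strictly for m = 1.  As Q has nonnegative entries, moments
   grow with the edge set.  If some vertex has degree at most k, then G is a
   spanning subgraph of K_{(n-1-k,1)k}.  Otherwise both sides S and T of a
   minimum edge cut have more than k + 1 vertices, and removing from S at most k
   endpoints of cut edges separates the rest of S from T: so G is a spanning
   subgraph of some K_{(p,q)k} with p, q > 1.  The spectrum of K_{(p,q)r} is
   explicit, and passing from (p, q) to (p + q - 1, 1) increases its moments. *)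

(** * Traces of powers as power sums of eigenvalues *)

Lemma conjmx_exp (F : fieldType) (n : nat) (P A : 'M[F]_n) (m : nat) :
  P \in unitmx -> (invmx P *m A *m P) ^+ m = invmx P *m A ^+ m *m P.
Proof.
move=> P_unit; elim: m => [|m IHm].
  by rewrite !expr0 mulmx1 mulVmx.
by rewrite !exprS IHm -!mulmxE !mulmxA mulmxK.
Qed.

Lemma char_poly_conjmx (F : fieldType) (n : nat) (P A : 'M[F]_n) :
  P \in unitmx -> char_poly (invmx P *m A *m P) = char_poly A.
Proof.
move=> P_unit; rewrite /char_poly /char_poly_mx.
have PV : map_mx polyC (invmx P) *m map_mx polyC P = 1%:M.
  by rewrite -map_mxM mulVmx // map_mx1.
have -> : 'X%:M - map_mx polyC (invmx P *m A *m P) =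
    map_mx polyC (invmx P) *m ('X%:M - map_mx polyC A) *m map_mx polyC P.
  by rewrite mulmxBr mulmxBl !map_mxM scalar_mxC -(mulmxA 'X%:M) PV mulmx1.
by rewrite !det_mulmx mulrAC -det_mulmx PV det1 mul1r.
Qed.

Lemma diag_mx_exp (F : pzSemiRingType) (n : nat) (D : 'rV[F]_n) (m : nat) :
  diag_mx D ^+ m = diag_mx (\row_i D 0 i ^+ m).
Proof.
elim: m => [|m IHm].
  by apply/matrixP => i j; rewrite expr0 !mxE expr0.
rewrite exprS IHm -mulmxE mulmx_diag; congr diag_mx.
by apply/rowP => i; rewrite !mxE exprS.
Qed.

(** The sequence [eigenvalues A] is known only through its factorization of the characteristic
    polynomial. Over the complex extension [A] is unitarily diagonalizable, and uniqueness of that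
    factorization matches the sequence with the diagonal up to order. *)
Lemma sum_eigenvalues_exp (R : realType) (n : nat) (A : 'M[R]_n) (m : nat) :
  A^T = A -> \sum_(q <- eigenvalues A) q ^+ m = \tr (A ^+ m).
Proof.
move=> symA; pose f := real_complex R; pose B := map_mx f A.
have hermB : B \is hermitianmx _ false Num.Def.conjC.
  apply: realsym_hermsym.
    apply/is_hermitianmxP; rewrite expr0 scale1r map_mx_id //.
    by apply/matrixP => i j; rewrite !mxE -{1}symA mxE.
  apply/mxOverP => i j; rewrite mxE; apply/complex_realP.
  by exists (A i j).
have /orthomx_spectralP eqB := hermitian_normalmx hermB.
have P_unit : spectralmx B \in unitmx by exact: spectral_unit.
set P := spectralmx B in eqB P_unit; set D := spectral_diag B in eqB.
have eig : perm_eq (map f (eigenvalues A)) [seq D 0 i | i : 'I_n].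
  apply: prod_XsubC_eq; rewrite big_map -[LHS]/(\prod_(q <- _) _).
  transitivity (char_poly B).
    rewrite -map_char_poly eigenvaluesP // rmorph_prod.
    by apply: eq_bigr => q _; rewrite rmorphB /= map_polyX map_polyC.
  rewrite eqB char_poly_conjmx // char_poly_trig ?diag_mx_is_trig //.
  by rewrite big_image; apply: eq_bigr => i _; rewrite mxE eqxx.
apply: (fmorph_inj f); rewrite rmorph_sum -trace_map_mx rmorphXn /= -/B.
rewrite {1}eqB conjmx_exp // mxtrace_mulC mulmxA mulmxV // mul1mx.
rewrite diag_mx_exp mxtrace_diag.
transitivity (\sum_(z <- map f (eigenvalues A)) z ^+ m).
  by rewrite big_map; apply: eq_bigr => q _; rewrite rmorphXn.
by rewrite (perm_big _ eig) big_image; apply: eq_bigr => i _; rewrite mxE.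
Qed.

(** * Spectral moments and the series for SLEE *)

Section SignlessLaplacianPowers.
Variable R : realType.
Implicit Types G H : sgraph.

(** Entries of Q and of its powers are indexed here by vertices instead of ordinals, so that they
    can be transported along maps between vertex sets. *)
Definition sl_entry G (x y : G) : R := (degree x)%:R *+ (x == y) + (adj x y)%:R.

Fixpoint sl_power G (m : nat) (x y : G) : R :=
  if m is m'.+1 then \sum_z sl_entry G x z * sl_power G m' z y else (x == y)%:R.

Definition spectral_moment G (m : nat) : R := \sum_x sl_power G m x x.

Lemma signless_laplacian_exp G (m : nat) i j :
  (signless_laplacian R G ^+ m) i j = sl_power G m (enum_val i) (enum_val j).
Proof.
elim: m i j => [|m IHm] i j /=.
  by rewrite expr0 mxE (inj_eq enum_val_inj).
rewrite exprS -mulmxE mxE (reindex _ (onW_bij _ (@enum_val_bij G))) /=.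
by apply: eq_bigr => l _; rewrite IHm !mxE /sl_entry (inj_eq enum_val_inj).
Qed.

Lemma mxtrace_signless_laplacian_exp G (m : nat) :
  \tr (signless_laplacian R G ^+ m) = spectral_moment G m.
Proof.
rewrite /spectral_moment (reindex _ (onW_bij _ (@enum_val_bij G))) /=.
by apply: eq_bigr => i _; rewrite signless_laplacian_exp.
Qed.

(** Each exponential is the limit of its Taylor sums; there are finitely many eigenvalues, so the
    limit commutes with the sum over them. *)
Lemma SLEE_series G :
  ((\sum_(0 <= m < N) spectral_moment G m / m`!%:R) @[N --> \oo]
     --> SLEE R G)%classic.
Proof.
rewrite /SLEE.
have -> : (fun N => \sum_(0 <= m < N) spectral_moment G m / m`!%:R) =
    (fun N => \sum_(q <- eigenvalues (signless_laplacian R G))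
       series (exp_coeff q) N).
  apply/funext => N; rewrite /series /= exchange_big /=.
  apply: eq_bigr => m _; rewrite -mxtrace_signless_laplacian_exp.
  rewrite -sum_eigenvalues_exp ?signless_laplacian_sym // mulr_suml.
  by apply: eq_bigr => q _; rewrite exp_coeffE mulrC.
apply: cvg_big => [|q _]; first exact: add_continuous.
exact: is_cvg_series_exp_coeff.
Qed.

Lemma le_SLEE G H :
  (forall m, spectral_moment G m <= spectral_moment H m) ->
  SLEE R G <= SLEE R H.
Proof.
move=> leGH; apply: (ler_cvg_to (SLEE_series G) (SLEE_series H)).
by near=> N; apply: ler_sum => m _; rewrite ler_pM2r ?invr_gt0 ?ltr0n ?fact_gt0.
Unshelve. all: by end_near. Qed.

(** Strictness survives the limit because the gap at m = 1 bounds from below the difference of all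
    partial sums with at least two terms. *)
Lemma lt_SLEE G H :
  (forall m, spectral_moment G m <= spectral_moment H m) ->
  spectral_moment G 1 < spectral_moment H 1 ->
  SLEE R G < SLEE R H.
Proof.
move=> leGH ltGH; rewrite -subr_gt0.
have : 0 < spectral_moment H 1 - spectral_moment G 1 by rewrite subr_gt0.
move=> /lt_le_trans; apply.
apply: (ler_cvg_to (cvg_cst _) (cvgB (SLEE_series H) (SLEE_series G))).
near=> N; have N_ge2 : (1 < N)%N by near: N; exists 2%N.
rewrite -[leRHS]/(\sum_(0 <= m < N) _ - \sum_(0 <= m < N) _) -sumrB /=.
rewrite (bigD1_seq 1%N) ?mem_index_iota ?iota_uniq //=.
rewrite !divr1 lerDl; apply: sumr_ge0 => m _.
by rewrite -mulrBl divr_ge0 ?subr_ge0 ?ler0n.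
Unshelve. all: by end_near. Qed.

End SignlessLaplacianPowers.

(** * Monotonicity of moments under adding edges *)

Section SpanningSubgraph.
Variable R : realType.
Implicit Types G H : sgraph.

Lemma spectral_moment1 G : spectral_moment R G 1 = \sum_(x : G) (degree x)%:R.
Proof.
apply: eq_bigr => x _ /=.
rewrite (bigD1 x) //= eqxx mulr1 big1 => [|z /negPf ->].
  by rewrite /sl_entry eqxx adj_irrefl !addr0.
by rewrite mulr0.
Qed.

Lemma sl_entry_ge0 G (x y : G) : 0 <= sl_entry R G x y.
Proof. by rewrite /sl_entry addr_ge0 ?mulrn_wge0 ?ler0n. Qed.

Lemma sl_power_ge0 G (m : nat) (x y : G) : 0 <= sl_power R G m x y.
Proof.
elim: m x => [|m IHm] x /=; first exact: ler0n.
by apply: sumr_ge0 => z _; rewrite mulr_ge0 ?sl_entry_ge0.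
Qed.

Variables (G H : sgraph) (f : G -> H).
Hypothesis f_bij : bijective f.
Hypothesis f_hom : forall x y, adj x y -> adj (f x) (f y).

Let f_inj : injective f := bij_inj f_bij.

Lemma hom_imset_neighbors (x : G) :
  f @: [set y | adj x y] \subset [set y | adj (f x) y].
Proof. by apply/subsetP => _ /imsetP[y + ->]; rewrite !inE => /f_hom. Qed.

Lemma hom_degree (x : G) : (degree x <= degree (f x))%N.
Proof.
by rewrite /degree -(card_imset _ f_inj) subset_leq_card ?hom_imset_neighbors.
Qed.

Lemma hom_sl_entry (x y : G) : sl_entry R G x y <= sl_entry R H (f x) (f y).
Proof.
rewrite /sl_entry (inj_eq f_inj) lerD ?lerMn2r ?ler_nat ?hom_degree ?orbT //.
by case: (boolP (adj x y)) => [/f_hom ->|].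
Qed.

Lemma hom_sl_power (m : nat) (x y : G) :
  sl_power R G m x y <= sl_power R H m (f x) (f y).
Proof.
elim: m x => [|m IHm] x /=; first by rewrite (inj_eq f_inj).
rewrite [leRHS](reindex f) ?ler_sum //=; last exact: onW_bij.
by move=> z _; rewrite ler_pM ?sl_entry_ge0 ?sl_power_ge0 ?hom_sl_entry.
Qed.

Lemma hom_spectral_moment (m : nat) :
  spectral_moment R G m <= spectral_moment R H m.
Proof.
rewrite /spectral_moment [leRHS](reindex f) ?ler_sum //=; last exact: onW_bij.
by move=> z _; exact: hom_sl_power.
Qed.

(** The first moment is the sum of the degrees, and [f] does not decrease any of them. Equal sums
    force equal degrees, so the image of each neighborhood fills the neighborhood of the image. *)
Lemma hom_adj_eq : spectral_moment R G 1 = spectral_moment R H 1 ->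
  forall x y, adj (f x) (f y) = adj x y.
Proof.
rewrite !spectral_moment1 [RHS](reindex f) /=; last exact: onW_bij.
rewrite -!natr_sum => /eqP; rewrite eqr_nat => /eqP eq_sum x y.
have eq_deg : degree (f x) = degree x.
  have [_] := leqif_sum (fun (z : G) (_ : true) => leqif_eq (hom_degree z)).
  by rewrite eq_sum eqxx => /esym/forallP/(_ x)/eqP.
apply/idP/idP => [adj_f|/f_hom //].
have /eqP eqN : f @: [set y | adj x y] == [set y | adj (f x) y].
  rewrite eqEcard hom_imset_neighbors card_imset //.
  exact: eq_leq eq_deg.
have : f y \in f @: [set y | adj x y] by rewrite eqN inE.
by rewrite mem_imset // inE.
Qed.

End SpanningSubgraph.

Lemma sg_iso_SLEE (R : realType) (G H : sgraph) :
  sg_iso G H -> SLEE R G = SLEE R H.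
Proof.
case=> f [f_bij f_adj]; have [g fK gK] := f_bij.
apply/eqP; rewrite eq_le !le_SLEE // => m.
  apply: (@hom_spectral_moment R H G g); first by exists f.
  by move=> x y; rewrite -f_adj !gK.
by apply: (@hom_spectral_moment R G H f) => // x y; rewrite f_adj.
Qed.

Lemma spanning_SLEE (R : realType) (G H : sgraph) (f : G -> H) :
  bijective f -> (forall x y, adj x y -> adj (f x) (f y)) ->
  SLEE R G <= SLEE R H /\ (SLEE R G = SLEE R H <-> sg_iso G H).
Proof.
move=> f_bij f_hom; have leGH := @hom_spectral_moment R _ _ _ f_bij f_hom.
split; first exact: le_SLEE.
split; last exact: sg_iso_SLEE.
move=> eqSLEE; exists f; split=> //; apply: (@hom_adj_eq R _ _ _ f_bij f_hom).
apply/eqP; rewrite eq_le leGH leNgt; apply/negP => /(lt_SLEE _ _ _ leGH).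
by rewrite eqSLEE ltxx.
Qed.

(** * Spectral moments of K_{(p,q)r} *)

(* The matrix on the right is the quotient of Q by the partition into the fibers
   of c: Q acts through it on vectors that are constant on fibers, and as mu_k
   on vectors supported on the k-th fiber and with zero sum. *)
Lemma spectral_moment_blocks (R : realType) (G : sgraph) (K : nat)
    (c : G -> 'I_K) (mu : 'rV[R]_K) (W : 'M[R]_K) (m : nat) :
  (forall x y, sl_entry R G x y = mu 0 (c x) *+ (x == y) + W (c x) (c y)) ->
  let N := \row_k (#|[set x | c x == k]|%:R : R) in
  spectral_moment R G m =
    \sum_k (N 0 k - 1) * mu 0 k ^+ m + \tr ((diag_mx mu + W *m diag_mx N) ^+ m).
Proof.
move=> sl_entryE N; set M := diag_mx mu + _.
have sum_c (F : 'I_K -> R) : \sum_x F (c x) = \sum_k N 0 k * F k.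
  rewrite (partition_big c xpredT) //=; apply: eq_bigr => k _.
  rewrite (eq_bigr (fun=> F k)) => [|x /eqP -> //].
  by rewrite big_const iter_addr_0 mxE mulr_natl -cardsE.
(* Powers of Q keep the shape of Q, diagonal plus constant on blocks, and the same block matrix [X]
   describes the powers of the quotient [M]. *)
have [X sl_powerE MX] : exists2 X : 'M[R]_K,
    forall x y,
      sl_power R G m x y = mu 0 (c x) ^+ m *+ (x == y) + X (c x) (c y)
    & M ^+ m = diag_mx (\row_k mu 0 k ^+ m) + X *m diag_mx N.
  elim: m => [|m [X sl_powerE MX]].
    exists 0 => [x y|]; first by rewrite mxE addr0.
    by rewrite mul0mx addr0 -diag_mx_exp.
  (* With D = diag mu, the product (D + W)(D^m + X), where sums over vertices weight classes by [N],
     has block part W D^m + D X + W N X = W D^m + M X. *)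
  exists (W *m diag_mx (\row_k mu 0 k ^+ m) + M *m X) => [x y|]; last first.
    rewrite exprS MX -mulmxE mulmxDr {1}/M mulmxDl mulmxDl !mulmxA -!addrA.
    rewrite -(mulmxA W) mulmx_diag -(mulmxA W (diag_mx (\row_k _))) mulmx_diag.
    rewrite mulmx_diag; congr (_ + (_ + _)); last congr (_ *m _); congr diag_mx.
      by apply/rowP => k; rewrite !mxE exprS.
    by apply/rowP => k; rewrite !mxE mulrC.
  rewrite /= (eq_bigr (fun z => (mu 0 (c x) *+ (x == z)) * sl_power R G m z y
     + (W (c x) (c z) * (mu 0 (c z) ^+ m *+ (z == y))
        + W (c x) (c z) * X (c z) (c y)))); last first.
    by move=> z _; rewrite sl_entryE mulrDl [in W _ _ * _]sl_powerE mulrDr.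
  rewrite !big_split /= (bigD1 x) //= eqxx big1 => [|z]; last first.
    by rewrite eq_sym => /negPf ->; rewrite mul0r.
  rewrite (bigD1 y) //= eqxx [\sum_(z | z != y) _]big1; last first.
    by move=> z /negPf ->; rewrite mulr0.
  rewrite (sum_c (fun k => W (c x) k * X k (c y))) sl_powerE.
  rewrite mulrDr exprS mulrnAr !mulr1n /M mulmxDl mul_diag_mx !mul_mx_diag.
  rewrite !addr0 -!addrA; congr (_ + _).
  rewrite addrCA [RHS]mxE; congr (_ + _); first by rewrite !mxE.
  rewrite [RHS]mxE; congr (_ + _); first by rewrite mxE.
  by rewrite mxE; apply: eq_bigr => k _; rewrite !mxE; ring.
rewrite /spectral_moment.
under eq_bigr do rewrite sl_powerE eqxx mulr1n.
rewrite (sum_c (fun k => mu 0 k ^+ m + X k k)) MX mxtraceD mxtrace_diag.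
rewrite /mxtrace -!big_split /=; apply: eq_bigr => k _.
by rewrite mul_mx_diag !mxE; ring.
Qed.

(** The first hypothesis says that (X - a)(X - b)(X - c) annihilates [M]. Traces and power sums then
    obey the same recurrence of order three and agree for m = 0, 1, 2. *)
Lemma tr_exp_cubic (F : comNzRingType) (M : 'M[F]_3) (a b c : F) (m : nat) :
  M ^+ 3 =
    (a + b + c) *: M ^+ 2 - (a * b + a * c + b * c) *: M + (a * b * c)%:M ->
  \tr M = a + b + c -> \tr (M ^+ 2) = a ^+ 2 + b ^+ 2 + c ^+ 2 ->
  \tr (M ^+ m) = a ^+ m + b ^+ m + c ^+ m.
Proof.
move=> CH tr1 tr2.
suff [] : [/\ \tr (M ^+ m) = a ^+ m + b ^+ m + c ^+ m,
   \tr (M ^+ m.+1) = a ^+ m.+1 + b ^+ m.+1 + c ^+ m.+1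
   & \tr (M ^+ m.+2) = a ^+ m.+2 + b ^+ m.+2 + c ^+ m.+2] by [].
elim: m => [|m [IH0 IH1 IH2]].
  by split; rewrite ?expr1 // expr0 mxtrace1 !expr0; ring.
split=> //.
have -> : M ^+ m.+3 = (a + b + c) *: M ^+ m.+2
    - (a * b + a * c + b * c) *: M ^+ m.+1 + (a * b * c) *: M ^+ m.
  rewrite -[m.+3]addn3 exprD CH mulrDr mulrBr -!mulmxE.
  rewrite -!scalemxAr mul_mx_scalar.
  by rewrite !mulmxE -exprD addn2 -exprSr.
rewrite mxtraceD linearB /= !mxtraceZ IH0 IH1 IH2 !exprS; ring.
Qed.

(** Only even powers of u survive in the binomial expansion of the sum, with nonnegative
    coefficients. The induction carries the sum and the difference together, since h - u may be
    negative. *)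
Lemma ler_exp_symmetric (R : realDomainType) (h u v : R) (m : nat) :
  0 <= h -> 0 <= u <= v ->
  (h + u) ^+ m + (h - u) ^+ m <= (h + v) ^+ m + (h - v) ^+ m.
Proof.
move=> h0 /andP[u0 uv].
suff [] : [/\ 0 <= (h + u) ^+ m - (h - u) ^+ m <= (h + v) ^+ m - (h - v) ^+ m
  & 0 <= (h + u) ^+ m + (h - u) ^+ m <= (h + v) ^+ m + (h - v) ^+ m]
  by move=> _ /andP[].
elim: m => [|m [/andP[D0 leD] /andP[S0 leS]]].
  by rewrite !expr0 subrr lexx /= lexx andbT; split=> //; rewrite addr_ge0.
rewrite !exprS.
set A := (h + u) ^+ m in D0 leD S0 leS *.
set B := (h - u) ^+ m in D0 leD S0 leS *.
set C := (h + v) ^+ m in leD leS *.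
set E := (h - v) ^+ m in leD leS *.
have -> : (h + u) * A - (h - u) * B = h * (A - B) + u * (A + B) by ring.
have -> : (h + v) * C - (h - v) * E = h * (C - E) + v * (C + E) by ring.
have -> : (h + u) * A + (h - u) * B = h * (A + B) + u * (A - B) by ring.
have -> : (h + v) * C + (h - v) * E = h * (C + E) + v * (C - E) by ring.
by split; apply/andP; split;
  rewrite ?lerD ?addr_ge0 ?mulr_ge0 ?ler_wpM2l // ler_pM.
Qed.

Definition Kpqr_class {p q r : nat} (x : Kpqr p q r) : 'I_3 :=
  match x with
  | inl (inl _) => inord 0
  | inl (inr _) => inord 1
  | inr _ => inord 2
  end.

Lemma natr_degree (R : pzSemiRingType) (G : sgraph) (x : G) :
  (degree x)%:R = \sum_y (adj x y)%:R :> R.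
Proof.
rewrite /degree -sum1_card natr_sum big_mkcond /=.
by apply: eq_bigr => y _; rewrite inE; case: adj.
Qed.

Lemma sum_neq_ord (R : pzRingType) (n : nat) (i : 'I_n) :
  \sum_(j < n) (i != j)%:R = n%:R - 1 :> R.
Proof.
rewrite (bigD1 i) //= eqxx add0r (eq_bigr (fun=> 1)) => [|j].
  rewrite sumr_const cardC1 card_ord -subn1 natrB //.
  exact: leq_trans (ltn_ord i).
by rewrite eq_sym => ->.
Qed.

Lemma card_Kpqr (p q r : nat) : #|Kpqr p q r| = (p + q + r)%N.
Proof. by rewrite !card_sum !card_ord. Qed.

(** Entries are functions on [nat], so that a product has again the form of its factors and the rule
    can be iterated. *)
Lemma mulmx33 (F : pzSemiRingType) (f g : nat -> nat -> F) :
  (\matrix_(i < 3, j < 3) f i j) *m (\matrix_(i < 3, j < 3) g i j) =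
  \matrix_(i < 3, j < 3)
    (f i 0%N * g 0%N j + (f i 1%N * g 1%N j + f i 2%N * g 2%N j)).
Proof.
by apply/matrixP => i j; rewrite !mxE !big_ord_recl big_ord0 !mxE /= addr0.
Qed.

Section KpqrTrace.
Variables (R : realType) (p q r : nat).

(** Each [mu] is a degree minus 1: [W] has ones on its diagonal, which counts every vertex as its
    own neighbor. *)
Let mu : 'rV[R]_3 :=
  \row_k [:: p%:R + r%:R - 2; q%:R + r%:R - 2; p%:R + q%:R + r%:R - 2]`_k.

Let W : 'M[R]_3 := \matrix_(i, j) [|| i == j, i == 2 :> nat | j == 2 :> nat]%:R.

Lemma Kpqr_sl_entry (x y : Kpqr p q r) :
  sl_entry R (Kpqr p q r) x y =
  mu 0 (Kpqr_class x) *+ (x == y) + W (Kpqr_class x) (Kpqr_class y).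
Proof.
have degE : (degree x)%:R = mu 0 (Kpqr_class x) + 1.
  rewrite natr_degree !big_sumType /=.
  case: x => [[i|i]|i] /=; rewrite mxE ?inordK //=.
  - by rewrite (sum_neq_ord R p i) !big_const_ord !iter_addr_0 mul0rn; ring.
  - by rewrite (sum_neq_ord R q i) !big_const_ord !iter_addr_0 mul0rn; ring.
  - by rewrite (sum_neq_ord R r i) !big_const_ord !iter_addr_0; ring.
rewrite /sl_entry degE [W _ _]mxE -(inj_eq val_inj (Kpqr_class x)).
case: x y {degE} => [[i|i]|i] [[j|j]|j];
  rewrite /= !inordK //= ?mulr0n ?add0r ?addr0 //.
all: rewrite ?eqxx ?orbT /complete_rel ?(inj_eq inl_inj) ?(inj_eq inr_inj).
all: by case: eqP => _; rewrite ?mulr1n ?mulr0n ?addr0 ?add0r.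
Qed.

Lemma card_Kpqr_class (k : 'I_3) :
  #|[set x : Kpqr p q r | Kpqr_class x == k]| = nth 0%N [:: p; q; r] k.
Proof.
rewrite -sum1_card big_mkcond /= !big_sumType /=.
under eq_bigr do rewrite inE -val_eqE /= inordK //.
under [X in (_ + X + _)%N]eq_bigr do rewrite inE -val_eqE /= inordK //.
under [X in (_ + _ + X)%N]eq_bigr do rewrite inE -val_eqE /= inordK //.
rewrite !big_const_ord !iter_addn_0.
by case: k => [[|[|[|k]]]] //= _; rewrite ?mul1n ?mul0n ?addn0 ?add0n.
Qed.

(* The quotient matrix has the eigenvalue p + q + r - 2, with eigenvector
   (r, -r, q - p), and two others with half-sum h and half-difference u. *)
Lemma Kpqr_spectral_moment (m : nat) (u : R)
    (h := p%:R + q%:R + r%:R * 3 / 2 - 2) :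
  u ^+ 2 = (p%:R + q%:R + r%:R / 2) ^+ 2 - 4 * p%:R * q%:R ->
  spectral_moment R (Kpqr p q r) m =
  (p%:R - 1) * (p%:R + r%:R - 2) ^+ m + (q%:R - 1) * (q%:R + r%:R - 2) ^+ m
  + r%:R * (p%:R + q%:R + r%:R - 2) ^+ m + ((h + u) ^+ m + (h - u) ^+ m).
Proof.
move=> u2; rewrite (spectral_moment_blocks _ _ _ _ _ _ _ Kpqr_sl_entry).
pose f i j := nth (0 : R) (nth [::]
     [:: [:: 2 * p%:R + r%:R - 2; 0; r%:R];
        [:: 0; 2 * q%:R + r%:R - 2; r%:R];
        [:: p%:R; q%:R; p%:R + q%:R + 2 * r%:R - 2]] i) j.
have -> : diag_mx mu
    + W *m diag_mx (\row_k #|[set x : Kpqr p q r | Kpqr_class x == k]|%:R) =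
    \matrix_(i < 3, j < 3) f i j.
  apply/matrixP => i j; rewrite mul_mx_diag !mxE card_Kpqr_class.
  by case: i j => [[|[|[|i]]]] // ? [[|[|[|j]]]] //= ?;
    rewrite /f /= ?mulr1n ?mulr0n; ring.
rewrite (@tr_exp_cubic _ _ (p%:R + q%:R + r%:R - 2) (h + u) (h - u)) //.
- rewrite !big_ord_recl big_ord0 !mxE !card_Kpqr_class /=; ring.
(* The annihilating cubic is checked entrywise. Its coefficients involve u only through (h + u)(h -
   u) = h^2 - u^2, which [u2] makes polynomial in p, q, r. *)
- set a := p%:R + q%:R + r%:R - 2.
  have -> : a + (h + u) + (h - u) = 3 * p%:R + 3 * q%:R + 4 * r%:R - 6.
    by rewrite /a /h; field.
  have hu : (h + u) * (h - u) =
      (r%:R - 2) * (2 * p%:R + 2 * q%:R + 2 * r%:R - 2) + 4 * p%:R * q%:R.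
    rewrite (_ : _ * _ = h ^+ 2 - u ^+ 2); last by ring.
    by rewrite u2 /h; field.
  have -> : a * (h + u) + a * (h - u) + (h + u) * (h - u) =
      a * (2 * p%:R + 2 * q%:R + 3 * r%:R - 4) + (h + u) * (h - u).
    by rewrite /h; field.
  rewrite -mulrA hu; apply/matrixP => i j.
  rewrite !exprS expr0 mulr1 -!mulmxE !(mulmx33 _ f f).
  rewrite (mulmx33 _ f (fun i j => f i 0%N * f 0%N j +
    (f i 1%N * f 1%N j + f i 2%N * f 2%N j))) /a !mxE -val_eqE /=.
  case: i j => [[|[|[|i]]]] // lti [[|[|[|j]]]] //= ltj;
    by rewrite /f /= ?mulr0n ?mulr1n; ring.
- by rewrite /mxtrace !big_ord_recl big_ord0 !mxE /f /= /h; field.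
rewrite expr2 -mulmxE !(mulmx33 _ f) /mxtrace !big_ord_recl big_ord0 !mxE /f /=.
transitivity ((p%:R + q%:R + r%:R - 2) ^+ 2 + h ^+ 2 * 2 + u ^+ 2 * 2);
  last by ring.
by rewrite u2 /h; field.
Qed.

End KpqrTrace.

(** The sum p + q - 2 of the multiplicities and the half-sum h are preserved. The eigenvalues p + r
    - 2 and q + r - 2 are both replaced by the larger p + q + r - 3, and the half-difference of the
    last pair grows. *)
Lemma lt_SLEE_Kpqr (R : realType) (p q r : nat) : (1 < p)%N -> (1 < q)%N ->
  SLEE R (Kpqr p q r) < SLEE R (Kpqr (p + q).-1 1 r).
Proof.
move=> p_gt1 q_gt1; set P : R := p%:R; set Q : R := q%:R; set S : R := r%:R.
have P2 : 2 <= P by rewrite (ler_nat _ 2).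
have Q2 : 2 <= Q by rewrite (ler_nat _ 2).
have S0 : 0 <= S by rewrite ler0n.
have PQ : (p + q).-1%:R = P + Q - 1 :> R.
  by rewrite -subn1 natrB ?natrD // addn_gt0 (ltnW p_gt1).
(* These are the values of u^2 for the two graphs; [z] is left unsimplified to show (P + Q - 1, 1)
   in place of (P, Q). *)
pose y := (P + Q + S / 2) ^+ 2 - 4 * P * Q.
pose z := (P + Q - 1 + 1 + S / 2) ^+ 2 - 4 * (P + Q - 1) * 1.
have y0 : 0 <= y.
  have -> : y = (P - Q) ^+ 2 + (P + Q) * S + (S / 2) ^+ 2 by rewrite /y; field.
  by rewrite !addr_ge0 ?sqr_ge0 // mulr_ge0 //; lra.
have yz : y <= z.
  have -> : z = y + 4 * ((P - 1) * (Q - 1)) by rewrite /y /z; ring.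
  by rewrite lerDl mulr_ge0 // mulr_ge0 // subr_ge0; lra.
have trG := Kpqr_spectral_moment R p q r _ _ (sqr_sqrtr y0).
have trH m : spectral_moment R (Kpqr (p + q).-1 1 r) m =
    (P + Q - 2) * (P + Q + S - 3) ^+ m + S * (P + Q + S - 2) ^+ m +
    ((P + Q + S * 3 / 2 - 2 + Num.sqrt z) ^+ m
     + (P + Q + S * 3 / 2 - 2 - Num.sqrt z) ^+ m).
  rewrite (Kpqr_spectral_moment _ _ _ _ _ (Num.sqrt z)); last first.
    by rewrite PQ sqr_sqrtr // (le_trans y0).
  rewrite PQ subrr mul0r addr0; congr (_ * _ ^+ _ + _ * _ ^+ _ + _).
  - ring.
  - ring.
  - ring.
  by congr (_ ^+ m + _ ^+ m); ring.
have le_exp (x : R) m :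
    0 <= x <= P + Q + S - 3 -> x ^+ m <= (P + Q + S - 3) ^+ m.
  by move=> /andP[x0 xle]; rewrite lerXn2r ?nnegrE // (le_trans x0).
apply: lt_SLEE => [m|].
  rewrite trG trH; apply: lerD; last first.
    apply: ler_exp_symmetric; first by rewrite -/P -/Q -/S; lra.
    by rewrite sqrtr_ge0 ler_sqrt // (le_trans y0).
  rewrite lerD2r (_ : P + Q - 2 = (P - 1) + (Q - 1)); last by ring.
  by rewrite [leRHS]mulrDl lerD // ler_wpM2l ?le_exp -/P -/Q -/S //; lra.
rewrite trG trH !expr1 -/P -/Q -/S.
(* The first moments differ by 2 (P - 1)(Q - 1). *)
have : 0 < (P - 1) * (Q - 1) by rewrite mulr_gt0 //; lra.
by nra.
Qed.

(** * Small edge cuts in graphs of large minimum degree *)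

(** Pairs are oriented out of [S], so each cut edge is counted once. *)
Definition edge_boundary (G : sgraph) (S : {set G}) : {set G * G} :=
  [set e | [&& e.1 \in S, e.2 \notin S & adj e.1 e.2]].

Lemma card_edge_boundaryC (G : sgraph) (S : {set G}) :
  #|edge_boundary G (~: S)| = #|edge_boundary G S|.
Proof.
have swapK : involutive (fun e : G * G => (e.2, e.1)) by case.
rewrite -(card_imset _ (inv_inj swapK)).
congr #|pred_of_set _|; apply/setP => e.
rewrite -[e]swapK mem_imset; last exact: inv_inj.
by rewrite !inE /= negbK adj_sym; case: (e.1 \in S); case: (e.2 \in S).
Qed.

(** Take for [S] a component left by a minimum disconnecting set [F]: every edge leaving [S] must
    lie in [F]. *)
Lemma small_edge_cut (G : sgraph) : (1 < #|G|)%N ->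
  exists S : {set G}, [/\ S != set0, S != setT &
    (#|edge_boundary G S| <= edge_connectivity G)%N].
Proof.
move=> G_gt1; have [[F /andP[_ disF] <-] _] := edge_connectivity_min G_gt1.
move: disF; rewrite /sg_connected negb_forall => /existsP[x].
rewrite negb_forall => /existsP[y xyN].
pose S := [set z : G | connect (@adj (del_edges F)) x z].
exists S; split.
- by apply/set0Pn; exists x; rewrite inE connect0.
- by apply: contraNneq xyN => /setP/(_ y); rewrite !inE.
pose f (e : G * G) := [set e.1; e.2].
(* Forgetting the orientation is injective on the boundary, as exactly one end of a cut edge lies in
   [S]. *)
rewrite -(card_in_imset (f := f)); last first.
  case=> u v [u' v']; rewrite !inE /= /f.
  move=> /and3P[uS vS _] /and3P[uS' vS' _] /= /setP eq_uv.
  have := eq_uv u; have := eq_uv v; rewrite !inE !eqxx orbT /=.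
  have [<-|_] := eqVneq u u'.
    by case: eqP uS vS => [->->|_ _ _ /esym/eqP ->].
  by move=> _ /esym/eqP eq_uv'; rewrite -eq_uv' uS in vS'.
apply/subset_leq_card/subsetP => _ /imsetP[[u v] + ->].
rewrite !inE /= => /and3P[uS vS adj_uv]; apply: contraNT vS => uvF.
by apply: connect_trans uS (connect1 _); rewrite /= /del_rel adj_uv.
Qed.

(* If instead every x in S had a neighbour h x outside S, then mapping y to
   (y, h y) or (u, y) would embed the neighbours of u in S into the boundary. *)
Lemma edge_boundary_inner (G : sgraph) (k : nat) (S : {set G}) :
  S != set0 -> (forall x : G, k < degree x)%N ->
  (#|edge_boundary G S| <= k)%N ->
  exists2 u, u \in S & [set y | adj u y] \subset S.
Proof.
case/set0Pn=> u uS deg_gt bd_le; apply/exists_inP; apply: contraT.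
rewrite negb_exists_in => /forall_inP noInner.
have h_ex (x : G) : exists y, (x \in S) ==> (adj x y && (y \notin S)).
  case: (boolP (x \in S)) => [xS|_]; last by exists x.
  by have /subsetPn[y] := noInner x xS; rewrite inE => ? ?;
    exists y; apply/andP.
pose h x := xchoose (h_ex x).
have hP x : x \in S -> adj x (h x) /\ h x \notin S.
  by move=> xS; exact/andP/(implyP (xchooseP (h_ex x))).
pose g y := if y \in S then (y, h y) else (u, y).
have g_inj : {in [set y | adj u y] &, injective g}.
  move=> y z; rewrite !inE => uy uz; rewrite /g.
  (* In the mixed cases, equal pairs would make [u] a neighbor of itself. *)
  case: ifP => yS; case: ifP => zS [] //.
    by move=> eq_yu; rewrite eq_yu adj_irrefl in uy.
  by move=> eq_uz; rewrite -eq_uz adj_irrefl in uz.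
have := deg_gt u; rewrite ltnNge => /negP[]; apply: leq_trans bd_le.
rewrite /degree -(card_in_imset g_inj).
apply/subset_leq_card/subsetP => _ /imsetP[y + ->].
rewrite !inE /g => uy; case: ifP => yS /=; last by rewrite uS yS.
by have [-> ->] := hP y yS; rewrite yS.
Qed.

(** An inner vertex lies in [S] together with its more than k neighbors. *)
Lemma edge_boundary_card (G : sgraph) (k : nat) (S : {set G}) :
  S != set0 -> (forall x : G, k < degree x)%N ->
  (#|edge_boundary G S| <= k)%N ->
  (k.+1 < #|S|)%N.
Proof.
move=> S0 deg_gt bd_le.
have [u uS sNS] := edge_boundary_inner _ _ _ S0 deg_gt bd_le.
apply: leq_ltn_trans (deg_gt u) _.
rewrite (cardsD1 u) uS ltnS; apply/subset_leq_card/subsetP => y uy.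
rewrite !inE (subsetP sNS) // andbT; apply: contraTneq uy => ->.
by rewrite inE adj_irrefl.
Qed.

(** * Spanning embeddings into K_{(p,q)r} *)

(** The cover and the count make [A], [B], [C] a partition, and K_{(p,q)r} lacks only the edges
    between its first two parts. The map is a section of the enumeration [h], hence injective, and
    bijective by cardinality. *)
Lemma spanning_Kpqr (G : sgraph) (A B C : {set G}) :
  (forall x : G, [\/ x \in A, x \in B | x \in C]) ->
  (#|G| = #|A| + #|B| + #|C|)%N ->
  (forall x y : G, x \in A -> y \in B -> ~~ adj x y) ->
  exists f : G -> Kpqr #|A| #|B| #|C|,
    bijective f /\ forall x y, adj x y -> adj (f x) (f y).
Proof.
move=> cover card noAB.
pose h (z : Kpqr #|A| #|B| #|C|) : G := match z with
  | inl (inl i) => enum_val i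
  | inl (inr i) => enum_val i
  | inr i => enum_val i
  end.
have h_surj x : exists z, h z == x.
  case: (cover x) => xS.
  - by exists (inl (inl (enum_rank_in xS x))); rewrite /= enum_rankK_in.
  - by exists (inl (inr (enum_rank_in xS x))); rewrite /= enum_rankK_in.
  - by exists (inr (enum_rank_in xS x)); rewrite /= enum_rankK_in.
pose f x := xchoose (h_surj x).
have fK : cancel f h by move=> x; exact/eqP/(xchooseP (h_surj x)).
have f_bij : bijective f.
  by apply: inj_card_bij (can_inj fK) _; rewrite card_Kpqr card.
exists f; split=> // x y; rewrite -{1}(fK x) -{1}(fK y).
case: (f x) (f y) => [[i|i]|i] [[j|j]|j] //=; rewrite /complete_rel.
- by apply: contraTneq => ->; rewrite adj_irrefl.
- by rewrite (negPf (noAB _ _ (enum_valP i) (enum_valP j))).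
- by rewrite adj_sym (negPf (noAB _ _ (enum_valP j) (enum_valP i))).
- by apply: contraTneq => ->; rewrite adj_irrefl.
- by apply: contraTneq => ->; rewrite adj_irrefl.
Qed.

Lemma subset_between (T : finType) (A C : {set T}) (k : nat) :
  A \subset C -> (#|A| <= k <= #|C|)%N ->
  exists B : {set T}, [/\ A \subset B, B \subset C & #|B| = k].
Proof.
move=> sAC /andP[leAk lekC].
have : (0 < #|[set D : {set T} | D \subset C :\: A & #|D| == (k - #|A|)%N]|)%N.
  by rewrite cards_draws bin_gt0 cardsDS // leq_sub2r.
case/card_gt0P=> D; rewrite inE subsetD => /andP[/andP[sDC dDA] /eqP cardD].
exists (A :|: D); rewrite subsetUl subUset sAC sDC; split=> //.
by rewrite cardsU setIC (disjoint_setI0 dDA) cards0 subn0 cardD subnKC.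
Qed.

(** Enlarge the neighborhood of [v] to a set of k vertices avoiding [v]: it becomes K_k, and [v]
    alone becomes K_1. *)
Lemma spanning_Kpqr1 (G : sgraph) (v : G) (k : nat) :
  (degree v <= k <= #|G| - 1)%N ->
  exists f : G -> Kpqr (#|G| - 1 - k) 1 k,
    bijective f /\ forall x y, adj x y -> adj (f x) (f y).
Proof.
move=> deg_k; pose N := [set y | adj v y].
have G_gt0 : (0 < #|G|)%N by apply/card_gt0P; exists v.
have cardvC : #|[set~ v]| = (#|G| - 1)%N by rewrite cardsCs setCK cards1.
have [||B [sNB sBv cardB]] := @subset_between _ N [set~ v] k;
    rewrite ?cardvC //.
  apply/subsetP => y; rewrite !inE; apply: contraTneq => ->.
  by rewrite adj_irrefl.
have vB : v \notin B by apply/negP => /(subsetP sBv); rewrite !inE eqxx.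
have cardA : #|~: (v |: B)| = (#|G| - 1 - k)%N.
  by rewrite cardsCs setCK cardsU1 vB cardB -subnDA.
have [|||f f_hom] := @spanning_Kpqr G (~: (v |: B)) [set v] B.
- move=> x; case: (boolP (x \in B)) => xB; first exact: Or33.
  have [->|xv] := eqVneq x v; first by apply: Or32; rewrite inE.
  by apply: Or31; rewrite !inE negb_or xv.
- by rewrite cardA cards1 cardB; lia.
- move=> x y; rewrite !inE negb_or => /andP[_ xB] /eqP ->.
  by apply: contra xB => xv; rewrite (subsetP sNB) // inE adj_sym.
by move: f f_hom; rewrite cardA cards1 cardB => f f_hom; exists f.
Qed.

Theorem theorem5p3 (R : realType) (G : sgraph) (n k : nat)
    (hn : #|G| = n) (n_gt0 : (0 < n)%N)
    (hk : edge_connectivity G = k) (k_le : (k <= n - 1)%N) :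
  SLEE R G <= SLEE R (Kpqr (n - 1 - k) 1 k) /\
  (SLEE R G = SLEE R (Kpqr (n - 1 - k) 1 k) <->
   sg_iso G (Kpqr (n - 1 - k) 1 k)).
Proof.
(* A vertex of degree at most k gives the spanning embedding directly, with the equality case; n = 1
   falls here. *)
have [/existsP[v deg_v]|] := boolP [exists v : G, (degree v <= k)%N].
  have [|f [f_bij f_hom]] := spanning_Kpqr1 G v k; first by rewrite deg_v hn.
  by move: f f_bij f_hom; rewrite hn => f; exact: spanning_SLEE.
rewrite negb_exists => /forallP deg_gt'.
have deg_gt (v : G) : (k < degree v)%N by rewrite ltnNge deg_gt'.
(* When all degrees exceed k the inequality is strict, so both sides of the equivalence are
   false. *)
suff ltGK : SLEE R G < SLEE R (Kpqr (n - 1 - k) 1 k).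
  split; [exact: ltW | split=> [eqGK | /(sg_iso_SLEE R) eqGK]];
    by rewrite eqGK ltxx in ltGK.
have G_gt1 : (1 < #|G|)%N.
  have /card_gt0P[v _] : (0 < #|G|)%N by rewrite hn.
  rewrite (cardD1 v) inE ltnS.
  apply: leq_trans (leq_trans _ (deg_gt v)) _ => //.
  apply/subset_leq_card/subsetP => y; rewrite !inE andbT.
  by apply: contraTneq => ->; rewrite adj_irrefl.
have [S [S0 ST bdS]] := small_edge_cut G G_gt1; rewrite hk in bdS.
have cardS := edge_boundary_card _ _ _ S0 deg_gt bdS.
have cardSC : (k.+1 < #|~: S|)%N.
  apply: edge_boundary_card deg_gt _; last by rewrite card_edge_boundaryC.
  by rewrite -setCT (inj_eq (@setC_inj _)).
(* These are the ends in [S] of cut edges. First projection maps the boundary onto [A], whence at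
   most k of them. *)
pose A := [set x in S | [exists y, (y \notin S) && adj x y]].
have leA : (#|A| <= k)%N.
  apply: leq_trans bdS; apply: leq_trans (leq_imset_card fst _).
  apply/subset_leq_card/subsetP => x; rewrite inE => /andP[xS /existsP[y yS]].
  by apply/imsetP; exists (x, y); rewrite ?inE //= xS.
(* Padding [A] to exactly k vertices inside [S] leaves at least two in [S :\: B], none adjacent to
   the complement of [S]. *)
have [||B [sAB sBS cardB]] := @subset_between _ A S k.
- by apply/subsetP => x; rewrite inE => /andP[].
- by rewrite leA (leq_trans _ cardS) // -addn2 leq_addr.
have [|||f [f_bij f_hom]] := @spanning_Kpqr G (S :\: B) (~: S) B.
- move=> x; case: (boolP (x \in B)) => xB; first exact: Or33.
  by case: (boolP (x \in S)) => xS; [apply: Or31 | apply: Or32];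
    rewrite !inE ?xB.
- by rewrite cardsDS // addnAC subnK ?subset_leq_card // cardsC.
- move=> x y; rewrite !inE => /andP[xB xS] yS; apply: contra xB => xy.
  by apply: (subsetP sAB); rewrite inE xS; apply/existsP; exists y; rewrite yS.
have [leGf _] := spanning_SLEE R _ _ f f_bij f_hom.
apply: (le_lt_trans leGf); rewrite cardsDS // cardB.
have := cardsC S; rewrite hn => cardSn.
have -> : (n - 1 - k)%N = (#|S| - k + #|~: S|).-1 by lia.
by apply: lt_SLEE_Kpqr; lia.
Qed.
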